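(* Let $f:\mathbb X\to\mathbb Y$ be a mapping between normed spaces, with $\mathbb Y$ partially ordered by a convex cone $\mathbb Y_+$, and let $\bar x\in\mathbb X$. Suppose that $f$ is $\mathbb Y_+$-convex and $$\mathbf 0^*\in\bigcup_{y^*\in\mathbb S^*\cap\mathbb Y^*_+}\mathrm{int}\,\partial(y^*\circ f)(\bar x).$$ Then $f$ is strongly metrically subregular at $\bar x$. Moreover, $$\mathrm{subreg}\,f(\bar x)\le\frac{1}{\varrho(f)(\bar x)}.$$
   Context: $B(x,r)$ denotes the closed ball with center $x$ and radius $r$. $\mathbb X^*$, $\mathbb Y^*$ are the topological duals, $\mathbf 0^*$ is the null vector of $\mathbb X^*$, $\mathbb B^*$ is the closed unit ball (here of $\mathbb X^*$) and $\mathbb S^*$ the unit sphere (here of $\mathbb Y^*$). The order on $\mathbb Y$ is $y_1\le_{\mathbb Y}y_2$ iff $y_2-y_1\in\mathbb Y_+$. $f$ is $\mathbb Y_+$-convex if $f(tx_1+(1-t)x_2)\le_{\mathbb Y}tf(x_1)+(1-t)f(x_2)$ for all $t\in[0,1]$ and $x_1,x_2\in\mathbb X$. $\mathbb Y^*_+=\{y^*\in\mathbb Y^*:\langle y^*,y\rangle\ge0,\ \forall y\in\mathbb Y_+\}$. $(y^*\circ f)(x)=\langle y^*,f(x)\rangle$, and $\partial$ is the subdifferential in the sense of convex analysis: $\partial\varphi(\bar x)=\{x^*\in\mathbb X^*:\varphi(x)\ge\varphi(\bar x)+\langle x^*,x-\bar x\rangle,\ \forall x\in\mathbb X\}$. $\mathrm{int}$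 is the norm-topology interior in $\mathbb X^*$. Define $$\varrho(f)(\bar x)=\sup\{\rho>0:\ \rho\mathbb B^*\subseteq\partial(y^*\circ f)(\bar x)\text{ for some }y^*\in\mathbb S^*\cap\mathbb Y^*_+\},$$ with $1/(+\infty)=0$. A mapping $f:\mathbb X\to\mathbb Y$ is metrically subregular at $\bar x$ if there exist $\kappa\ge 0$ and $r>0$ such that $\mathrm{dist}(x,f^{-1}(f(\bar x)))\le\kappa\|f(x)-f(\bar x)\|$ for all $x\in B(\bar x,r)$; the modulus $\mathrm{subreg}\,f(\bar x)$ is the infimum of all $\kappa\ge 0$ for which such an $r$ exists. It is strongly metrically subregular at $\bar x$ if, in addition, $\bar x$ is an isolated point of $f^{-1}(f(\bar x))$; equivalently, if there exist $\kappa\ge0$, $r>0$ with $\|x-\bar x\|\le\kappa\|f(x)-f(\bar x)\|$ for all $x\in B(\bar x,r)$. *)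

(* Defs.v *)
From HB Require Import structures.
From mathcomp Require Import all_boot all_order all_algebra.
From mathcomp Require Import all_classical all_reals all_analysis.

Set Implicit Arguments.
Unset Strict Implicit.
Unset Printing Implicit Defensive.

Import Order.TTheory GRing.Theory Num.Theory.
Import numFieldNormedType.Exports.

Local Open Scope classical_set_scope.
Local Open Scope ring_scope.

Section Dual.
Context {R : realType} (X : normedModType R).

Definition continuous_linear : {pred X -> R} :=
  [pred u : X -> R | `[< linear u /\ continuous u >]].

Lemma continuous_linear_submod_closed : submod_closed continuous_linear.
Proof.
split.
  apply/asboolP; split; last exact: cst_continuous.
  by move=> a x y /=; rewrite scaler0 addr0.
move=> a u v /asboolP[ul uc] /asboolP[vl vc]; apply/asboolP; split.
  move=> b x y; rewrite !fctE ul vl !scalerDr !scalerA mulrC.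
  by rewrite addrACA.
move=> x; apply: cvgD; last exact: vc.
by apply: cvgZl_tmp; exact: uc.
Qed.

HB.instance Definition _ := GRing.isSubmodClosed.Build R (X -> R)
  continuous_linear continuous_linear_submod_closed.

Record dual := Dual {
  dual_fun :> X -> R;
  dual_funP : dual_fun \in continuous_linear }.

HB.instance Definition _ := [isSub for dual_fun].
HB.instance Definition _ := [Choice of dual by <:].
HB.instance Definition _ := [SubChoice_isSubLmodule of dual by <:].

Definition dual_norm (u : dual) : R :=
  sup [set `|u x| | x in closed_ball (0 : X) 1].

Lemma dual_linear (u : dual) : linear u.
Proof. by have /asboolP[] := dual_funP u. Qed.

Lemma dual_continuous (u : dual) : continuous u.
Proof. by have /asboolP[] := dual_funP u. Qed.

HB.instance Definition _ (u : dual) :=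
  GRing.isLinear.Build R X R _ u (dual_linear u).

Let unit_ballE : closed_ball (0 : X) 1 = [set x : X | `|x| <= 1].
Proof.
by rewrite closed_ballE//; apply/seteqP; split=> x /=;
  rewrite /closed_ball_/= sub0r normrN.
Qed.

Lemma dual_norm_has_sup (u : dual) :
  has_sup [set `|u x| | x in closed_ball (0 : X) 1].
Proof.
split; first by exists `|u 0|, 0 => //; rewrite unit_ballE /= normr0.
have /linear_bounded_continuous/linear_boundedP := @dual_continuous u.
move=> /pinfty_ex_gt0[M M0 uM]; exists M => _ [x + <-].
rewrite unit_ballE /= => x1; apply: (le_trans (uM x)).
by rewrite ler_piMr// ltW.
Qed.

Lemma dual_norm_le (u : dual) (M : R) :
  (forall x, `|x| <= 1 -> `|u x| <= M) -> dual_norm u <= M.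
Proof.
move=> uM; apply: ge_sup; first by have [] := dual_norm_has_sup u.
by move=> _ [x + <-]; rewrite unit_ballE; exact: uM.
Qed.

Lemma le_dual_norm1 (u : dual) (x : X) : `|x| <= 1 -> `|u x| <= dual_norm u.
Proof.
move=> x1; apply: ub_le_sup; first by have [] := dual_norm_has_sup u.
by exists x => //; rewrite unit_ballE.
Qed.

Lemma dual_norm_ge0 (u : dual) : 0 <= dual_norm u.
Proof. by rewrite (le_trans (normr_ge0 (u 0)))// le_dual_norm1// normr0. Qed.

Lemma le_dual_norm (u : dual) (x : X) : `|u x| <= dual_norm u * `|x|.
Proof.
have [->|x0] := eqVneq x 0; first by rewrite raddf0 !normr0 mulr0.
have nx0 : 0 < `|x| by rewrite normr_gt0.
rewrite -ler_pdivrMr// mulrC -[`|x|^-1]gtr0_norm ?invr_gt0// -normrM.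
have <- : u (`|x|^-1 *: x) = `|x|^-1 * u x by rewrite linearZ.
by apply: le_dual_norm1; rewrite normrZ normfV normr_id mulVf// gt_eqF.
Qed.

Let dual_normD (u v : dual) : dual_norm (u + v) <= dual_norm u + dual_norm v.
Proof.
apply: dual_norm_le => x x1; rewrite (le_trans (ler_normD (u x) (v x)))//.
by rewrite lerD// le_dual_norm1.
Qed.

Let dual_normZ (a : R) (u : dual) : dual_norm (a *: u) = `|a| * dual_norm u.
Proof.
have leZ b v : dual_norm (b *: v) <= `|b| * dual_norm v.
  apply: dual_norm_le => x x1; rewrite [X in `|X|](_ : _ = b * v x)//.
  by rewrite normrM ler_wpM2l// le_dual_norm1.
apply/eqP; rewrite eq_le leZ/=.
have [->|a0] := eqVneq a 0; first by rewrite normr0 mul0r dual_norm_ge0.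
rewrite -ler_pdivlMl ?normr_gt0// -normfV (le_trans _ (leZ a^-1 (a *: u)))//.
by rewrite scalerA mulVf// scale1r.
Qed.

Let dual_norm0_eq0 (u : dual) : dual_norm u = 0 -> u = 0.
Proof.
move=> u0; apply/val_inj/funext => x /=; apply/eqP; rewrite -normr_le0.
by rewrite (le_trans (le_dual_norm u x))// u0 mul0r.
Qed.

HB.instance Definition _ :=
  @Lmodule_isNormed.Build R dual dual_norm dual_normD dual_normZ dual_norm0_eq0.

Lemma dual_normE (u : dual) : `|u| = dual_norm u.
Proof. by []. Qed.

End Dual.

Section ConeOrder.
Context {R : realType} {X Y : normedModType R}.

(* Neither closedness nor pointedness is required: cone_le is reflexive and
   transitive, but need not be antisymmetric. *)
Definition convex_cone (C : set Y) :=
  [/\ C !=set0, (forall (t : R) y, 0 <= t -> C y -> C (t *: y)) &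
      @convex_set R Y C].

Definition cone_le (C : set Y) (y1 y2 : Y) := C (y2 - y1).

Definition cone_convex (C : set Y) (f : X -> Y) :=
  forall (t : R) (x1 x2 : X), 0 <= t <= 1 ->
    cone_le C (f (t *: x1 + (1 - t) *: x2)) (t *: f x1 + (1 - t) *: f x2).

Definition dual_cone (C : set Y) : set (dual Y) :=
  [set v | forall y, C y -> 0 <= v y].

Definition dual_sphere : set (dual Y) := [set v | `|v| = 1].

End ConeOrder.

Section Subdifferential.
Context {R : realType} {X Y : normedModType R}.

Definition subdifferential (phi : X -> R) (xbar : X) : set (dual X) :=
  [set u | forall x, phi x >= phi xbar + u (x - xbar)].

(* The supremum is taken in \bar R, so it can be +oo, and it is -oo when no
   positive rho is admissible. *)
Definition varrho (C : set Y) (f : X -> Y) (xbar : X) : \bar R :=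
  ereal_sup [set rho%:E | rho in [set rho : R | 0 < rho /\
    exists2 v, (dual_sphere `&` dual_cone C) v &
      [set rho *: u | u in closed_ball (0 : dual X) 1]
        `<=` subdifferential (v \o f) xbar]].

End Subdifferential.

Section Subregularity.
Context {R : realType} {X Y : normedModType R}.
Implicit Types (f : X -> Y) (xbar : X).

Definition subreg_constant f xbar (kappa : R) :=
  0 <= kappa /\ exists2 r : R, 0 < r & forall x, closed_ball xbar r x ->
    (edist_inf (f @^-1` [set f xbar]) x <= (kappa * `|f x - f xbar|)%:E)%E.

Definition metrically_subregular f xbar := exists kappa, subreg_constant f xbar kappa.

Definition subreg f xbar : \bar R :=
  ereal_inf [set kappa%:E | kappa in subreg_constant f xbar].

Definition strongly_metrically_subregular f xbar :=
  metrically_subregular f xbar /\ isolated (f @^-1` [set f xbar]) xbar.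

End Subregularity.

(* Main.v *)
From HB Require Import structures.
Require Import Defs.
From mathcomp Require Import all_boot all_order all_algebra.
From mathcomp Require Import all_classical all_reals all_analysis.
Import Order.TTheory GRing.Theory Num.Theory.
Import numFieldNormedType.Exports.
Local Open Scope classical_set_scope.
Local Open Scope ring_scope.

Set Implicit Arguments.
Unset Strict Implicit.
Unset Printing Implicit Defensive.

(** Let [rho > 0] and let the functional [v] of norm 1 be such that [rho] times
    the dual unit ball consists of subgradients of [v \o f] at [xbar].  For
    each [u] in the dual unit ball,
      [`|f x - f xbar| >= v (f x - f xbar) >= rho * u (x - xbar)],
    and choosing for [u] a norming functional of [x - xbar] gives the global
    estimate [rho * `|x - xbar| <= `|f x - f xbar|] ([subdiff_ball_growth]).
    Hence the fibre of [f] through [xbar] is reduced to [xbar], and [rho^-1] is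
    a subregularity constant.  The interiority hypothesis provides one such
    [rho], hence strong subregularity; the supremum over all of them gives the
    bound on the modulus.

    Norming functionals come from the Hahn-Banach theorem, proved here through
    minimal sublinear functionals rather than by extending partially defined
    linear ones.  By Zorn's lemma, below each sublinear functional there is a
    minimal one ([exists_minimal_sublinear]).  Any sublinear [p] can be lowered
    along a direction [h] to a sublinear functional whose value at [- h] is at
    most [- p h] ([sublinear_descent]).  When [p] is minimal nothing is gained,
    so [p (- h) = - p h] for every [h], which makes [p] linear.  When [p] is
    the norm, a linear functional below the lowered one takes the value
    [`|h|] at [h]. *)

(** * Sublinear functionals and the Hahn-Banach theorem *)

Section Sublinear.
Context {R : realType} {V : lmodType R}.
Implicit Types (p q : V -> R) (x y h : V).

(** Positive homogeneity is required as an inequality, because this form passes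
    directly to infima; equality follows, see [sublinearZ]. *)
Definition sublinear p :=
  (forall x y, p (x + y) <= p x + p y) /\
  (forall (t : R) x, 0 <= t -> p (t *: x) <= t * p x).

Lemma sublinear0 p : sublinear p -> p 0 = 0.
Proof.
move=> [pD pZ]; apply/eqP; rewrite eq_le; apply/andP; split.
  by have := pZ 0 0 (lexx 0); rewrite scale0r mul0r.
by have := pD 0 0; rewrite addr0 -lerBlDr subrr.
Qed.

Lemma sublinear_geN p x : sublinear p -> - p (- x) <= p x.
Proof.
move=> sp; have := sp.1 x (- x).
by rewrite subrr sublinear0// -lerBlDr sub0r.
Qed.

Lemma sublinearZ p (t : R) x : sublinear p -> 0 <= t -> p (t *: x) = t * p x.
Proof.
move=> sp t0; apply/eqP; rewrite eq_le sp.2//=.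
move: t0; rewrite [0 <= t]le_eqVlt => /predU1P[<-|t0].
  by rewrite mul0r scale0r sublinear0.
rewrite -ler_pdivlMl//; apply: le_trans (sp.2 t^-1 _ _); last first.
  by rewrite invr_ge0 ltW.
by rewrite scalerA mulVf ?scale1r// gt_eqF.
Qed.

(** Sublinearity of a pointwise infimum needs only that upper estimates can be
    matched inside the family; this covers both the infimum of a chain and the
    infimum along a half-line. *)
Lemma sublinear_inf (E : V -> set R) :
  (forall x, E x !=set0) -> (forall x, has_lbound (E x)) ->
  (forall x y a b, E x a -> E y b -> exists2 c, E (x + y) c & c <= a + b) ->
  (forall (t : R) x a, 0 <= t -> E x a ->
    exists2 c, E (t *: x) c & c <= t * a) ->
  sublinear (fun x => inf (E x)).
Proof.
move=> E0 Elb ED EZ; split=> [x y|t x t0].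
  rewrite -lerBlDl; apply: lb_le_inf => // b Eb.
  rewrite lerBlDl -lerBlDr; apply: lb_le_inf => // a Ea.
  have [c Ec cab] := ED _ _ _ _ Ea Eb.
  by rewrite lerBlDr (le_trans _ cab)// ge_inf.
move: t0; rewrite [0 <= t]le_eqVlt => /predU1P[<-|t0].
  have [a Ea] := E0 x; have [c Ec] := EZ 0 x a (lexx 0) Ea.
  by rewrite !mul0r => c0; rewrite (le_trans _ c0)// ge_inf.
rewrite -ler_pdivrMl//; apply: lb_le_inf => // a Ea.
have [c Ec ca] := EZ _ _ _ (ltW t0) Ea.
by rewrite ler_pdivrMl// (le_trans _ ca)// ge_inf.
Qed.

(** The lowered functional is [x |-> inf_(t >= 0) (p (x + t *: h) - t * p h)];
    the terms [t = 0] and, at [x = - h], [t = 1] give the two estimates. *)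
Lemma sublinear_descent p h : sublinear p ->
  exists q, [/\ sublinear q, forall x, q x <= p x & q (- h) <= - p h].
Proof.
move=> sp.
pose E x := [set p (x + t *: h) - t * p h | t in [set t : R | 0 <= t]].
have E0 x : E x (p x) by exists 0 => //=; rewrite scale0r mul0r addr0 subr0.
have Elb x : has_lbound (E x).
  exists (- p (- x)) => _ [t /= t0 <-].
  rewrite lerBrDr addrC -sublinearZ// lerBlDr.
  by apply: le_trans (sp.1 _ _); rewrite addrC addKr.
exists (fun x => inf (E x)); split.
- apply: sublinear_inf => // [x|x y _ _ [t /= t0 <-] [s /= s0 <-]|].
  + by exists (p x).
  + exists (p (x + y + (t + s) *: h) - (t + s) * p h).
      by exists (t + s) => //=; exact: addr_ge0.
    rewrite scalerDl mulrDl opprD [in leRHS]addrACA lerD2r.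
    by rewrite addrACA sp.1.
  + move=> c x _ c0 [t /= t0 <-].
    exists (p (c *: x + (c * t) *: h) - (c * t) * p h).
      by exists (c * t) => //=; exact: mulr_ge0.
    by rewrite -scalerA -scalerDr mulrBr mulrA lerD2r sp.2.
- by move=> x; exact: ge_inf.
- apply: ge_inf => //; exists 1 => //=.
  by rewrite scale1r addNr mul1r sublinear0// sub0r.
Qed.

(** Zorn's lemma applies because a chain below [q] has a pointwise infimum: each
    member [p] satisfies [p x >= - p (- x) >= - q (- x)], a bound that does not
    depend on [p]. *)
Lemma exists_minimal_sublinear q : sublinear q ->
  exists p, [/\ sublinear p, forall x, p x <= q x &
    forall p', sublinear p' -> (forall x, p' x <= p x) ->
      forall x, p x <= p' x].
Proof.
move=> sq; pose T := {p | sublinear p /\ forall x, p x <= q x}.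
pose t0 : T := exist _ q (conj sq (fun x => lexx (q x))).
pose below : rel T := fun s t => `[< forall x, sval t x <= sval s x >].
have [||A Atot|[p [sp pq]] pmin] := @ZL_preorder T t0 below.
- by move=> t; apply/asboolP.
- move=> r s t /asboolP rs /asboolP st; apply/asboolP => x.
  exact: le_trans (st x) (rs x).
- have [A0|/set0P[a0 Aa0]] := eqVneq A set0.
    by exists t0 => s; rewrite A0.
  pose E x := [set sval p x | p in A].
  have Elb x : has_lbound (E x).
    exists (- q (- x)) => _ [[p [sp pq]] _ <-] /=.
    by apply: le_trans (sublinear_geN x sp); rewrite lerN2.
  have EA t x : A t -> E x (sval t x) by exists t.
  have sP : sublinear (fun x => inf (E x)).
    apply: sublinear_inf => //.
    + by move=> x; exists (sval a0 x); exact: EA.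
    + move=> x y _ _ [s As <-] [t At <-].
      (* Of two members of a chain, the smaller one bounds both terms. *)
      have [/asboolP st|/asboolP ts] := Atot _ _ As At.
      * exists (sval t (x + y)); first exact: EA.
        by rewrite (le_trans ((svalP t).1.1 x y))// lerD2r.
      * exists (sval s (x + y)); first exact: EA.
        by rewrite (le_trans ((svalP s).1.1 x y))// lerD2l.
    + move=> c x _ c0 [t At <-]; exists (sval t (c *: x)); first exact: EA.
      exact: (svalP t).1.2.
  have Pq x : inf (E x) <= q x.
    by apply: le_trans ((svalP a0).2 x); apply: ge_inf => //; exact: EA.
  exists (exist _ (fun x => inf (E x)) (conj sP Pq)) => s As.
  apply/asboolP => x /=.
  by apply: ge_inf => //; exact: EA.
exists p; split=> // p' sp' p'p x.
have p'q y : p' y <= q y := le_trans (p'p y) (pq y).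
have /asboolP := pmin (exist _ p' (conj sp' p'q)) (asboolT p'p).
exact.
Qed.

(** Subadditivity of [p], read at [- a] and [- b], becomes superadditivity by
    oddness.  The codomain is [R^o] because [linear] asks for a module. *)
Lemma sublinear_odd_linear p : sublinear p -> (forall x, p (- x) = - p x) ->
  linear (p : V -> R^o).
Proof.
move=> sp pN t x y.
have pD a b : p (a + b) = p a + p b.
  apply/eqP; rewrite eq_le sp.1/= -[leRHS]opprK -pN opprD.
  by rewrite lerNr opprD -!pN sp.1.
rewrite pD; congr (_ + _).
have [t0|/ltW t0] := leP 0 t; first by rewrite sublinearZ.
rewrite -[t]opprK scaleNr pN sublinearZ ?oppr_ge0//.
by rewrite scaleNr.
Qed.

Lemma linear_below_sublinear q : sublinear q ->
  exists p : V -> R^o, linear p /\ forall x, p x <= q x.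
Proof.
move=> /exists_minimal_sublinear[p [sp pq pmin]]; exists p; split=> //.
apply: sublinear_odd_linear => // h.
have [p' [sp' p'p p'h]] := sublinear_descent h sp.
apply/eqP; rewrite eq_le (le_trans (pmin _ sp' p'p _) p'h)/=.
by rewrite lerNl sublinear_geN.
Qed.

End Sublinear.

(** A functional below the norm is continuous with dual norm at most 1; starting
    from the norm lowered along [x0] forces [u (- x0) <= - `|x0|]. *)
Lemma norming_functional {R : realType} {X : normedModType R} (x0 : X) :
  exists u : dual X, `|u| <= 1 /\ `|x0| <= u x0.
Proof.
have snorm : sublinear (fun x : X => `|x|).
  split=> [x y|t x t0]; first exact: ler_normD.
  by rewrite normrZ ger0_norm.
have [q [sq qnorm qx0]] := sublinear_descent x0 snorm.
have [u [ulin uq]] := linear_below_sublinear sq.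
pose u' : {linear X -> R^o} :=
  HB.pack u (GRing.isLinear.Build R X R^o *:%R u ulin).
have u_le x : `|u x| <= `|x|.
  rewrite ler_norml (le_trans (uq x) (qnorm x)) andbT lerNl.
  have -> : - u x = u' (- x) by rewrite linearN.
  by rewrite -normrN (le_trans (uq _) (qnorm _)).
have ucont : continuous u.
  apply/(linear_bounded_continuous u')/linear_boundedP.
  exists 1; split=> // r /ltW r1 x.
  by rewrite (le_trans (u_le x))// ler_peMl.
have uP : (u : X -> R) \in @continuous_linear R X by apply/asboolP.
exists (Dual uP); split.
  by rewrite dual_normE; apply: dual_norm_le => x; exact: le_trans.
rewrite /= -lerN2; apply: le_trans qx0.
have -> : - u x0 = u' (- x0) by rewrite linearN.
exact: uq.
Qed.

(** * Growth and subregularity *)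

Section Growth.
Context {R : realType} {X Y : normedModType R}.
Implicit Types (f : X -> Y) (xbar : X) (v : dual Y) (rho : R).

Lemma subdiff_ball_growth f xbar v rho : 0 < rho -> `|v| = 1 ->
  [set rho *: u | u in closed_ball (0 : dual X) 1]
    `<=` subdifferential (v \o f) xbar ->
  forall x, rho * `|x - xbar| <= `|f x - f xbar|.
Proof.
move=> rho0 v1 ball_sub x.
have [u [u1 ux]] := norming_functional (x - xbar).
have ru : [set rho *: u | u in closed_ball (0 : dual X) 1] (rho *: u).
  by exists u => //; rewrite closed_ballE// /closed_ball_/= sub0r normrN.
have le_v : v (f xbar) + rho * u (x - xbar) <= v (f x) := ball_sub _ ru x.
rewrite -lerBrDl -raddfB in le_v.
apply: le_trans (ler_wpM2l (ltW rho0) ux) _; apply: le_trans le_v _.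
apply: le_trans (ler_norm _) (le_trans (le_dual_norm _ _) _).
by rewrite -dual_normE v1 mul1r.
Qed.

(** [edist] is an infimum over open balls, whence radii slightly larger than
    the norm. *)
Lemma edist_le_norm (x y : X) : (edist (x, y) <= `|x - y|%:E)%E.
Proof.
apply/lee_addgt0Pr => e e0; rewrite -EFinD; apply: edist_fin => /=.
  by rewrite ltr_wpDl.
by rewrite -ball_normE /ball_/= ltrDl.
Qed.

Lemma growth_subreg_constant f xbar rho : 0 < rho ->
  (forall x, rho * `|x - xbar| <= `|f x - f xbar|) ->
  subreg_constant f xbar rho^-1.
Proof.
move=> rho0 growth; split; first by rewrite invr_ge0 ltW.
exists 1 => // x _.
have := edist_inf_triangle (f @^-1` [set f xbar]) x xbar.
rewrite (@edist_inf0 _ _ _ xbar)// adde0 => /le_trans; apply.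
by rewrite (le_trans (edist_le_norm _ _))// lee_fin ler_pdivlMl.
Qed.

Lemma growth_isolated f xbar rho : 0 < rho ->
  (forall x, rho * `|x - xbar| <= `|f x - f xbar|) ->
  isolated (f @^-1` [set f xbar]) xbar.
Proof.
move=> rho0 growth; split; first exact/mem_set.
exists setT; first exact: filterT.
rewrite setTI; apply/seteqP; split=> [x /= fx|x ->//].
have := growth x; rewrite fx subrr normr0 pmulr_rle0// normr_le0 subr_eq0.
by move/eqP.
Qed.

(** An open ball in the dual contains the closed ball of half its radius. *)
Lemma interior0_closed_ball (A : set (dual X)) : (interior A) 0 ->
  exists2 rho : R, 0 < rho &
    [set rho *: u | u in closed_ball (0 : dual X) 1] `<=` A.
Proof.
move=> /nbhs_ballP[e /= e0 eA]; exists (e / 2); first by rewrite divr_gt0.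
move=> _ [u + <-]; rewrite closed_ballE// /closed_ball_/= sub0r normrN => u1.
apply: eA; rewrite -ball_normE /ball_/= sub0r normrN normrZ.
rewrite gtr0_norm ?divr_gt0//.
apply: (@le_lt_trans _ _ (e / 2)); first by rewrite ler_piMr// divr_ge0// ltW.
by rewrite ltr_pdivrMr// ltr_pMr// ltr1n.
Qed.

Lemma subreg_ge0 f xbar : (0 <= subreg f xbar)%E.
Proof. by apply: le_ereal_inf_tmp => _ [k [k0 _] <-]; rewrite lee_fin. Qed.

End Growth.

Theorem theorem6 (R : realType) (X Y : normedModType R) (Yplus : set Y)
    (f : X -> Y) (xbar : X)
    (Yplus_cone : convex_cone Yplus)
    (f_convex : cone_convex Yplus f)
    (int0 : (\bigcup_(v in dual_sphere `&` dual_cone Yplus)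
               interior (subdifferential (v \o f) xbar)) (0 : dual X)) :
  strongly_metrically_subregular f xbar /\
  (subreg f xbar <= (varrho Yplus f xbar)^-1)%E.
Proof.
case: int0 => v [v1 vC] /interior0_closed_ball[rho rho0 ball_sub]; split.
  have growth := subdiff_ball_growth rho0 v1 ball_sub.
  split; last exact: growth_isolated growth.
  by exists rho^-1; exact: growth_subreg_constant.
have varrho_ge0 : (0 <= varrho Yplus f xbar)%E.
  apply: le_ereal_sup_tmp; exists rho%:E; last by rewrite lee_fin ltW.
  by exists rho => //; split=> //; exists v.
(* Inverting both sides turns the claim into an upper bound on a supremum. *)
rewrite inve_pge ?inE ?subreg_ge0//.
apply: ge_ereal_sup => _ [r [r0 [w [w1 _] wsub]] <-].
rewrite inve_pge ?inE ?subreg_ge0 ?lee_fin ?(ltW r0)// inver gt_eqF//.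
apply: ereal_inf_lbound; exists r^-1 => //.
exact: growth_subreg_constant (subdiff_ball_growth r0 w1 wsub).
Qed.
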